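(* Let $(X,\Upsilon)$ be a $\mathsf{UG}$-space, i.e. a set $X$ with a uniform system $\Upsilon$. Then $(X,\Upsilon)$ is probabilistic metrizable if and only if there are functions $d_\lambda\in[0,\infty]^{X\times X}$ ($0<\lambda\le1$) such that $\Psi=\{d_\lambda\mid0<\lambda\le1\}$ is a uniform basis of $(X,\Upsilon)$ (that is, $\Psi$ is a uniform basis and $\Upsilon=\langle\Psi\rangle$), and such that the following hold: (US) $d_\lambda(x,y)=d_\lambda(y,x)$ for all $0<\lambda\le1$ and $x,y\in X$; (UD) $d_\lambda=\inf_{0<\rho<\lambda}d_\rho$ (pointwise) for all $0<\lambda\le1$; (UT) for some continuous t-norm $*$: for all $\varepsilon,\lambda,\lambda'\in\,]0,1]$ with $(1-\lambda')*(1-\lambda)>1-\varepsilon$ and all $x,y,z\in X$, $d_\varepsilon(x,z)\le d_\lambda(x,y)+d_{\lambda'}(y,z)$; (UH) for all $x\ne y$ in $X$ there exists $\lambda$ with $0<\lambda\le1$ and $d_\lambda(x,y)>0$.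
   Context: A continuous t-norm is a binary operation $*$ on $[0,1]$ such that $([0,1],*,1)$ is a commutative monoid, $*:[0,1]^2\to[0,1]$ is continuous, and $p*q\le p'*q'$ whenever $p\le p'$, $q\le q'$. A distance distribution is a nondecreasing function $\varphi:[0,\infty]\to[0,1]$ with $\varphi(0)=0$, $\varphi(\infty)=1$, left-continuous on $]0,\infty[$. The largest one, $\varepsilon_0$, has $\varepsilon_0(0)=0$ and $\varepsilon_0(t)=1$ for $t>0$. A probabilistic metric space $(X,\alpha,* )$ is a set $X$ with a map $\alpha:X\times X\times[0,\infty]\to[0,1]$ and a continuous t-norm $*$ such that for all $x,y,z\in X$, $r,s\in[0,\infty]$: (P1) $\alpha(x,y,-)$ is a distance distribution; (P2) $\alpha(x,x,-)=\varepsilon_0$; (P3) $\alpha(x,y,r)=\alpha(y,x,r)$; (P4) $\alpha(x,y,-)=\varepsilon_0$ implies $x=y$; (P5) $\alpha(y,z,r)*\alpha(x,y,s)\le\alpha(x,z,r+s)$. An ideal in $[0,\infty]^{X\times X}$ (pointwise order) is a nonempty subset that is downward closed and closed under finite pointwise suprema; an ideal basis is a nonempty subset $\Psi$ such that for all $d,e\in\Psi$ there is $c\in\Psi$ with $d\vee e\le c$. Write $d^{-1}(x,y)=d(y,x)$. A uniform system on $X$ is an ideal $\Upsilon\subseteq[0,\infty]^{X\times X}$ such that: (AU1) $d(x,x)=0$ for all $d\in\Upsilon$, $x\in X$; (AU2) if $e\in[0,\infty]^{X\times X}$ is such that for all $\varepsilon>0$, $N<\infty$ there is $d_\varepsilon^N\in\Upsilon$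 with $e\wedge N\le d_\varepsilon^N+\varepsilon$, then $e\in\Upsilon$; (AU3) for all $d\in\Upsilon$, $N<\infty$ there is $e^N\in\Upsilon$ such that $d(x,z)\wedge N\le e^N(x,y)+e^N(y,z)$ for all $x,y,z\in X$; (AU4) $d\in\Upsilon$ implies $d^{-1}\in\Upsilon$. A uniform basis is an ideal basis $\Psi\subseteq[0,\infty]^{X\times X}$ satisfying (AU1), (AU3), (AU4) (with $\Psi$ in place of $\Upsilon$). It generates the uniform system $\langle\Psi\rangle=\{d\in[0,\infty]^{X\times X}\mid\forall\varepsilon>0,\forall N<\infty,\exists d_\varepsilon^N\in\Psi: d\wedge N\le d_\varepsilon^N+\varepsilon\}$. The underlying $\mathsf{UG}$-space $\Lambda(X,\alpha,* )$ of a probabilistic metric space $(X,\alpha,* )$ is the set $X$ with the uniform system generated by the uniform basis $\{d^\alpha_\lambda\mid0<\lambda\le1\}$, where $d^\alpha_\lambda(x,y)=\inf\{0\le\gamma<\infty\mid\alpha(x,y,\gamma)>1-\lambda\}$ (with $\inf\emptyset=\infty$). A $\mathsf{UG}$-space is probabilistic metrizable if it is the underlying $\mathsf{UG}$-space of some probabilistic metric space $(X,\alpha,* )$, for some continuous t-norm $*$. *)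

(* Defs.v *)
From HB Require Import structures.
From mathcomp Require Import all_boot all_order all_algebra.
From mathcomp Require Import all_classical all_reals all_analysis.
Set Implicit Arguments.
Unset Strict Implicit.
Unset Printing Implicit Defensive.
Import Order.TTheory GRing.Theory Num.Theory.
Import numFieldNormedType.Exports.
Local Open Scope classical_set_scope.
Local Open Scope ring_scope.

(* The values [op p q] matter only for [p], [q] in [0,1]. *)
Record continuous_tnorm (R : realType) (op : R -> R -> R) : Prop := {
  tnorm_itv : forall p q : R, `[0, 1]%classic p -> `[0, 1]%classic q ->
    `[0, 1]%classic (op p q) ;
  tnormA : forall p q r : R, `[0, 1]%classic p -> `[0, 1]%classic q ->
    `[0, 1]%classic r -> op p (op q r) = op (op p q) r ;
  tnormC : forall p q : R, `[0, 1]%classic p -> `[0, 1]%classic q ->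
    op p q = op q p ;
  tnorm1 : forall p : R, `[0, 1]%classic p -> op 1 p = p ;
  tnorm_continuous :
    {within `[0, 1]%classic `*` `[0, 1]%classic,
      continuous (fun pq : R * R => op pq.1 pq.2)} ;
  tnorm_le : forall p p' q q' : R, `[0, 1]%classic p -> `[0, 1]%classic p' ->
    `[0, 1]%classic q -> `[0, 1]%classic q' ->
    p <= p' -> q <= q' -> op p q <= op p' q' }.

(* A function [0,oo] -> [0,1] is encoded as [phi : \bar R -> R], whose values
   at negative arguments are ignored. *)
Record distance_distribution (R : realType) (phi : \bar R -> R) : Prop := {
  dd_itv : forall t, (0 <= t)%E -> `[0, 1]%classic (phi t) ;
  dd_le : forall s t, (0 <= s)%E -> (s <= t)%E -> phi s <= phi t ;
  dd0 : phi 0%E = 0 ;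
  ddy : phi +oo%E = 1 ;
  dd_left_continuous : forall t : R, 0 < t ->
    phi s%:E @[s --> t^'-] --> phi t%:E }.

Definition epsilon0 (R : realType) (t : \bar R) : R :=
  if (0 < t)%E then 1 else 0.

Record probabilistic_metric_space (R : realType) (X : Type)
    (alpha : X -> X -> \bar R -> R) (op : R -> R -> R) : Prop := {
  pm_tnorm : continuous_tnorm op ;
  pm_P1 : forall x y, distance_distribution (alpha x y) ;
  pm_P2 : forall x t, (0 <= t)%E -> alpha x x t = epsilon0 t ;
  pm_P3 : forall x y r, (0 <= r)%E -> alpha x y r = alpha y x r ;
  pm_P4 : forall x y,
    (forall t, (0 <= t)%E -> alpha x y t = epsilon0 t) -> x = y ;
  pm_P5 : forall x y z r s, (0 <= r)%E -> (0 <= s)%E ->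
    op (alpha y z r) (alpha x y s) <= alpha x z (r + s)%E }.

(* The set [0,oo]^(X x X). *)
Definition distfuns (R : realType) (X : Type) : set (X -> X -> \bar R) :=
  [set d | forall x y, (0 <= d x y)%E].

Record ideal (R : realType) (X : Type) (U : set (X -> X -> \bar R)) : Prop := {
  ideal_sub : U `<=` @distfuns R X ;
  ideal_nonempty : U !=set0 ;
  ideal_down : forall d e, U d -> distfuns e ->
    (forall x y, (e x y <= d x y)%E) -> U e ;
  ideal_max : forall d e, U d -> U e -> U (fun x y => maxe (d x y) (e x y)) }.

Record ideal_basis (R : realType) (X : Type) (Psi : set (X -> X -> \bar R)) :
    Prop := {
  ibasis_sub : Psi `<=` @distfuns R X ;
  ibasis_nonempty : Psi !=set0 ;
  ibasis_directed : forall d e, Psi d -> Psi e -> exists2 c, Psi c &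
    forall x y, (maxe (d x y) (e x y) <= c x y)%E }.

Definition AU1 (R : realType) (X : Type) (U : set (X -> X -> \bar R)) : Prop :=
  forall d x, U d -> d x x = 0%E.

Definition approximable (R : realType) (X : Type) (U : set (X -> X -> \bar R))
    (e : X -> X -> \bar R) : Prop :=
  forall eps N : R, 0 < eps -> 0 <= N -> exists2 d, U d &
    forall x y, (mine (e x y) N%:E <= d x y + eps%:E)%E.

Definition AU2 (R : realType) (X : Type) (U : set (X -> X -> \bar R)) : Prop :=
  forall e, distfuns e -> approximable U e -> U e.

Definition AU3 (R : realType) (X : Type) (U : set (X -> X -> \bar R)) : Prop :=
  forall d (N : R), U d -> 0 <= N -> exists2 e, U e &
    forall x y z, (mine (d x z) N%:E <= e x y + e y z)%E.

Definition AU4 (R : realType) (X : Type) (U : set (X -> X -> \bar R)) : Prop :=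
  forall d, U d -> U (fun x y => d y x).

Record uniform_system (R : realType) (X : Type)
    (U : set (X -> X -> \bar R)) : Prop := {
  usys_ideal : ideal U ;
  usys_AU1 : AU1 U ;
  usys_AU2 : AU2 U ;
  usys_AU3 : AU3 U ;
  usys_AU4 : AU4 U }.

Record uniform_basis (R : realType) (X : Type)
    (Psi : set (X -> X -> \bar R)) : Prop := {
  ubasis_ideal_basis : ideal_basis Psi ;
  ubasis_AU1 : AU1 Psi ;
  ubasis_AU3 : AU3 Psi ;
  ubasis_AU4 : AU4 Psi }.

Definition generated (R : realType) (X : Type)
    (Psi : set (X -> X -> \bar R)) : set (X -> X -> \bar R) :=
  [set d | distfuns d /\ approximable Psi d].

Definition dalpha (R : realType) (X : Type) (alpha : X -> X -> \bar R -> R)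
    (lambda : R) (x y : X) : \bar R :=
  ereal_inf [set gamma%:E | gamma in
    [set gamma : R | 0 <= gamma /\ 1 - lambda < alpha x y gamma%:E]].

(* The uniform system of the underlying UG-space of a probabilistic metric
   space. *)
Definition Lambda (R : realType) (X : Type) (alpha : X -> X -> \bar R -> R) :
    set (X -> X -> \bar R) :=
  generated (dalpha alpha @` `]0, 1]%classic).

Definition probabilistic_metrizable (R : realType) (X : Type)
    (U : set (X -> X -> \bar R)) : Prop :=
  exists (alpha : X -> X -> \bar R -> R) (op : R -> R -> R),
    probabilistic_metric_space alpha op /\ U = Lambda alpha.

(* Main.v *)
Require Import Defs.
From HB Require Import structures.
From mathcomp Require Import all_boot all_order all_algebra.
From mathcomp Require Import all_classical all_reals all_analysis.
From mathcomp Require Import lra.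
Import Order.TTheory GRing.Theory Num.Theory.
Import numFieldNormedType.Exports.
Local Open Scope classical_set_scope.
Local Open Scope ring_scope.

(** A probabilistic metric [alpha] and a family of levels [d] are two encodings
    of the same data, tied by the Galois connection
    [d lambda x y < t <-> 1 - lambda < alpha x y t]
    for [0 < lambda <= 1] and real [t >= 0], called [adjoint] below.

    Left continuity of the distance distributions makes [dalpha alpha] adjoint
    to [alpha] ([dalpha_adjoint]). Conversely, given [d], the only candidate
    for [alpha x y t] at real [t] is the supremum of the [1 - lambda] with
    [d lambda x y < t], and (UD) makes this supremum adjoint to [d]
    ([dist_of_adjoint]). The levels are determined by the adjunction
    ([adjoint_eq]), so the levels of the recovered metric are the given [d],
    and both generate the same uniform system.

    It remains to match the axioms across the connection. Symmetry, the value
    on the diagonal, separation, monotonicity and left continuity translate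
    directly. From the probabilistic triangle inequality to (UT)
    ([adjoint_triangle]), a number above [d lambda x y + d lambda' y z] splits
    as [r + s] with [r] and [s] above the two summands, and monotonicity of
    the t-norm concludes. In the other direction ([adjoint_prob_triangle]), if
    [alpha x z (r + s) = a] were below [op (alpha y z r) (alpha x y s)],
    continuity would give [p'] and [q'] strictly below the two arguments with
    [a < op p' q'] ([tnorm_lt_approx]); (UT) at the levels [1 - a], [1 - q'],
    [1 - p'] then gives [d (1 - a) x z < r + s], that is [a < a]. The same
    approximation at [op 1 1 = 1] yields the uniform triangle condition
    (AU3) for the family [dalpha alpha] ([dalpha_uniform_basis]). *)

(** * Extended reals and t-norms *)

Lemma lee_lt_fin {R : realType} {a b : \bar R} : (0 <= b)%E ->
  (forall t : R, 0 <= t -> (b < t%:E)%E -> (a <= t%:E)%E) -> (a <= b)%E.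
Proof.
move=> b0 ab; apply/lee_addgt0Pr => e e0.
case: b b0 ab => [r| |] //=; rewrite ?leey//.
rewrite lee_fin => r0 ab; rewrite -EFinD; apply: ab.
  by rewrite addr_ge0// ltW.
by rewrite lte_fin ltrDl.
Qed.

Lemma itv01P {R : realType} {p : R} : `[0, 1]%classic p <-> 0 <= p <= 1.
Proof. by rewrite /= in_itv. Qed.

(** Lower semicontinuity of the t-norm, in the form that fits suprema: strict
    lower bounds of [op p q] persist at arguments strictly below [p] and [q],
    which is where levels are available. *)
Lemma tnorm_lt_approx {R : realType} {op : R -> R -> R} {p q a : R} :
  continuous_tnorm op -> 0 < p <= 1 -> 0 < q <= 1 -> a < op p q ->
  exists p' q', [/\ 0 <= p' < p, 0 <= q' < q & a < op p' q'].
Proof.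
move=> Top /andP[p0 p1] /andP[q0 q1] apq.
have pqI : (`[0, 1]%classic `*` `[0, 1]%classic) (p, q).
  by split; apply/itv01P => /=; rewrite ltW.
have /subspace_continuousP/(_ _ pqI) opc := tnorm_continuous Top.
have := cvgr_gt _ opc a apq.
rewrite near_withinE => opn.
have /nbhs_ballP[e /= e0 He] : nbhs (p, q) (fun z : R * R =>
  (`[0, 1]%classic `*` `[0, 1]%classic) z -> a < op z.1 z.2) by exact: opn.
have close (u : R) : 0 < u -> u <= 1 ->
    exists u', [/\ 0 <= u' < u, `[0, 1]%classic u' & ball u e u'].
  move=> u0 u1; exists (Num.max 0 (u - e / 2)).
  have ? : 0 <= Num.max 0 (u - e / 2) < u.
    by rewrite le_max lexx/= gt_max u0/= ltrBlDr ltrDl divr_gt0.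
  split=> //; first by apply/itv01P; lra.
  rewrite /ball /= ger0_norm; last by lra.
  rewrite ltrBlDr -ltrBlDl lt_max; apply/orP; right; lra.
have [p' [p'p p'I pp']] := close _ p0 p1.
have [q' [q'q q'I qq']] := close _ q0 q1.
exists p', q'; split=> //.
exact: (He (p', q') (conj pp' qq') (conj p'I q'I)).
Qed.

Lemma tnorm0 {R : realType} {op : R -> R -> R} {q : R} :
  continuous_tnorm op -> 0 <= q <= 1 -> op 0 q = 0 /\ op q 0 = 0.
Proof.
move=> Top q01.
have I0 : `[0, 1]%classic (0 : R) by apply/itv01P; rewrite lexx ler01.
have I1 : `[0, 1]%classic (1 : R) by apply/itv01P; rewrite lexx ler01.
have Iq : `[0, 1]%classic q by apply/itv01P.
rewrite (tnormC Top Iq I0); suff -> : op 0 q = 0 by [].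
apply/le_anti/andP; split; last by have /itv01P/andP[] := tnorm_itv Top I0 Iq.
rewrite -[leRHS](tnorm1 Top I0) (tnormC Top I1 I0).
by apply: (tnorm_le Top) => //; case/andP: q01.
Qed.

(** * The Galois connection between levels and distributions *)

Definition adjoint {R : realType} {X : Type} (d : R -> X -> X -> \bar R)
    (alpha : X -> X -> \bar R -> R) : Prop :=
  forall lambda x y t, 0 < lambda <= 1 -> 0 <= t ->
    (d lambda x y < t%:E)%E = (1 - lambda < alpha x y t%:E).

Lemma dalpha_ge0 {R : realType} {X : Type} {alpha : X -> X -> \bar R -> R}
  {lambda : R} {x y : X} : (0 <= dalpha alpha lambda x y)%E.
Proof. by apply: le_ereal_inf_tmp => _ [t [t0 _] <-]; rewrite lee_fin. Qed.

(** Left continuity is what makes the infimum defining [dalpha] strictly less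
    than [t]: if [1 - lambda < alpha x y t], this persists at some [s < t]. *)
Lemma dalpha_adjoint {R : realType} {X : Type}
  {alpha : X -> X -> \bar R -> R} :
  (forall x y, distance_distribution (alpha x y)) ->
  adjoint (dalpha alpha) alpha.
Proof.
move=> dd lambda x y t /andP[l0 l1] t0; apply/idP/idP.
  move=> /ereal_inf_lt[_ [s [s0 ls] <-] /ltW st].
  by rewrite (lt_le_trans ls)//; apply: (dd_le (dd x y)).
move=> lt.
have {}t0 : 0 < t.
  rewrite lt_neqAle t0 andbT; apply/eqP => t0'.
  by move: lt; rewrite -t0' (dd0 (dd x y)); lra.
have H := cvgr_gt _ (dd_left_continuous (dd x y) t0) _ lt.
near t^'- => s.
apply: (@le_lt_trans _ _ s%:E); last first.
  by rewrite lte_fin; near: s; exact: nbhs_left_lt.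
apply: ereal_inf_lbound; exists s => //; split.
  by near: s; exact: nbhs_left_ge.
by near: s; exact: H.
Unshelve. all: by end_near. Qed.

(** A nonnegative extended real is determined by the reals above it. *)
Lemma adjoint_eq {R : realType} {X : Type} {d d' : R -> X -> X -> \bar R}
  {alpha : X -> X -> \bar R -> R} {lambda : R} :
  (forall x y, 0 <= d lambda x y)%E -> (forall x y, 0 <= d' lambda x y)%E ->
  adjoint d alpha -> adjoint d' alpha -> 0 < lambda <= 1 ->
  d lambda = d' lambda.
Proof.
move=> d0 d'0 da d'a l01; apply/funext => x; apply/funext => y.
apply/le_anti/andP; split; apply: lee_lt_fin => // t t0.
  by rewrite d'a// -da// => /ltW.
by rewrite da// -d'a// => /ltW.
Qed.

Lemma adjoint_antitone {R : realType} {X : Type}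
  {d : R -> X -> X -> \bar R} {alpha : X -> X -> \bar R -> R}
  {lambda mu : R} {x y : X} : adjoint d alpha -> (0 <= d mu x y)%E ->
  0 < mu -> mu <= lambda -> lambda <= 1 -> (d lambda x y <= d mu x y)%E.
Proof.
move=> ad d0 m0 ml l1; apply: lee_lt_fin => // t t0.
rewrite ad//; last by lra.
move=> mt; apply: ltW; rewrite ad//; last by lra.
by apply: le_lt_trans mt; lra.
Qed.

(** Inequalities between distributions can be read off the levels: were the
    conclusion false, the level [lambda := 1 - alpha x' y' t] would separate
    the two values. Monotonicity and symmetry both follow from this. *)
Lemma adjoint_le {R : realType} {X : Type}
  {d : R -> X -> X -> \bar R} {alpha : X -> X -> \bar R -> R}
  {x y x' y' : X} {s t : R} : adjoint d alpha -> 0 <= s -> 0 <= t ->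
  alpha x y s%:E <= 1 -> 0 <= alpha x' y' t%:E ->
  (forall lambda, 0 < lambda <= 1 ->
    (d lambda x y < s%:E)%E -> (d lambda x' y' < t%:E)%E) ->
  alpha x y s%:E <= alpha x' y' t%:E.
Proof.
move=> ad s0 t0 as1 at0 dd; rewrite leNgt; apply/negP => ts.
have l01 : 0 < 1 - alpha x' y' t%:E <= 1 by lra.
by have := dd _ l01; rewrite !ad// subKr ltxx => /(_ ts).
Qed.

(** (UD) reflects that [1 - lambda < alpha x y t] is an open condition on
    [lambda]: it still holds at the midpoint of [1 - alpha x y t] and
    [lambda]. *)
Lemma adjoint_inf_below {R : realType} {X : Type}
  {d : R -> X -> X -> \bar R} {alpha : X -> X -> \bar R -> R} :
  adjoint d alpha ->
  (forall lambda x y, 0 < lambda <= 1 -> (0 <= d lambda x y)%E) ->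
  (forall x y (t : R), 0 <= t -> alpha x y t%:E <= 1) ->
  forall (lambda : R) (x y : X), 0 < lambda <= 1 ->
    d lambda x y =
    ereal_inf [set d rho x y | rho in [set rho : R | 0 < rho < lambda]].
Proof.
move=> ad d0 a1 l x y l01; apply/le_anti/andP; split.
  apply: le_ereal_inf_tmp => _ [r /= rl <-].
  by apply: (adjoint_antitone ad); rewrite ?d0//; lra.
apply: lee_lt_fin => [|t t0]; first exact: d0.
have := a1 x y _ t0; rewrite ad// => at1 lt.
apply: (@le_trans _ _ (d ((l + (1 - alpha x y t%:E)) / 2) x y)).
  by apply: ereal_inf_lbound;
    exists ((l + (1 - alpha x y t%:E)) / 2) => //=; lra.
by apply: ltW; rewrite ad//; lra.
Qed.

(** * The two triangle inequalities *)

Lemma adjoint_triangle {R : realType} {X : Type} {d : R -> X -> X -> \bar R}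
  {alpha : X -> X -> \bar R -> R} {op : R -> R -> R} :
  probabilistic_metric_space alpha op -> adjoint d alpha ->
  (forall lambda x y, 0 < lambda <= 1 -> (0 <= d lambda x y)%E) ->
  forall eps lambda lambda' : R, 0 < eps <= 1 ->
    0 < lambda <= 1 -> 0 < lambda' <= 1 ->
    op (1 - lambda') (1 - lambda) > 1 - eps ->
    forall x y z, (d eps x z <= d lambda x y + d lambda' y z)%E.
Proof.
move=> pm ad d0 eps l l' e01 l01 l'01 opl x y z.
have dI u v t : 0 <= t -> `[0, 1]%classic (alpha u v t%:E).
  by move=> t0; apply: (dd_itv (pm_P1 pm u v)); rewrite lee_fin.
have split_lt (a b : \bar R) (t : R) : (0 <= a)%E -> (0 <= b)%E ->
    (a + b < t%:E)%E -> exists r s : R,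
    [/\ 0 <= r, 0 <= s, r + s = t, (a < r%:E)%E & (b < s%:E)%E].
  case: a => [a| |]//; case: b => [b| |]//.
  rewrite -EFinD !lee_fin lte_fin => a0 b0 abt.
  exists (a + (t - (a + b)) / 2), (b + (t - (a + b)) / 2).
  by rewrite !lte_fin; split; lra.
apply: lee_lt_fin => [|t t0 /split_lt]; first by rewrite adde_ge0// d0.
move=> /(_ (d0 _ _ _ l01) (d0 _ _ _ l'01)) [r [s [r0 s0 <-]]].
rewrite !ad// => lr ls; apply: ltW; rewrite ad//; last exact: addr_ge0.
apply: lt_le_trans opl _.
rewrite (addrC r) EFinD.
apply: (le_trans _ (@pm_P5 _ _ _ _ pm x y z s%:E r%:E _ _)); rewrite ?lee_fin//.
apply: (tnorm_le (pm_tnorm pm)); rewrite ?ltW//; try exact: dI.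
  by apply/itv01P; lra.
by apply/itv01P; lra.
Qed.

(** The failure of the probabilistic inequality is approximated from strictly
    below, because the adjunction turns only the strict inequalities
    [p' < alpha y z r] and [q' < alpha x y s] into bounds on levels. *)
Lemma adjoint_prob_triangle {R : realType} {X : Type}
  {d : R -> X -> X -> \bar R} {alpha : X -> X -> \bar R -> R}
  {op : R -> R -> R} : adjoint d alpha -> continuous_tnorm op ->
  (forall x y (t : R), 0 <= t -> 0 <= alpha x y t%:E <= 1) ->
  (forall eps lambda lambda' : R, 0 < eps <= 1 ->
    0 < lambda <= 1 -> 0 < lambda' <= 1 ->
    op (1 - lambda') (1 - lambda) > 1 - eps ->
    forall x y z, (d eps x z <= d lambda x y + d lambda' y z)%E) ->
  forall x y z (r s : R), 0 <= r -> 0 <= s ->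
    op (alpha y z r%:E) (alpha x y s%:E) <= alpha x z (r%:E + s%:E)%E.
Proof.
move=> ad Top a01 ut x y z r s r0 s0; rewrite -EFinD leNgt; apply/negP.
have rs0 : 0 <= r + s by exact: addr_ge0.
have p01 := a01 y z _ r0; have q01 := a01 x y _ s0.
have a01' := a01 x z _ rs0.
set a := alpha x z _ in a01' *; set p := alpha y z _ in p01 *.
set q := alpha x y _ in q01 * => aop.
(* A zero argument makes [op] vanish, so it cannot exceed [a >= 0]. *)
have p0 : 0 < p.
  rewrite lt_neqAle; case/andP: (p01) => -> _; rewrite andbT; apply/eqP => p0.
  by move: aop; rewrite -p0 (tnorm0 Top q01).1; lra.
have q0 : 0 < q.
  rewrite lt_neqAle; case/andP: (q01) => -> _; rewrite andbT; apply/eqP => q0.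
  by move: aop; rewrite -q0 (tnorm0 Top p01).2; lra.
have p0' : 0 < p <= 1 by lra.
have q0' : 0 < q <= 1 by lra.
have [p' [q' [p'p q'q aop']]] := tnorm_lt_approx Top p0' q0' aop.
have op1 : op p q <= 1.
  suff /itv01P/andP[]: `[0, 1]%classic (op p q) by [].
  by apply: (tnorm_itv Top); apply/itv01P.
have e01 : 0 < 1 - a <= 1 by lra.
have l01 : 0 < 1 - q' <= 1 by lra.
have l'01 : 0 < 1 - p' <= 1 by lra.
have ltx : (d (1 - q')%R x y < s%:E)%E by rewrite ad// -/q; lra.
have lty : (d (1 - p')%R y z < r%:E)%E by rewrite ad// -/p; lra.
have : (d (1 - a)%R x z < (r + s)%:E)%E.
  apply: le_lt_trans (ut _ _ _ e01 l01 l'01 _ x y z) _; first by rewrite !subKr.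
  by rewrite addrC EFinD lteD.
by rewrite ad// subKr ltxx.
Qed.

(** * From levels to a probabilistic metric *)

(** At a real argument where no level is below [r], the supremum is that of
    the empty set, which is [0]: the least possible value of a distance
    distribution. The value at [+oo] is prescribed. *)
Definition dist_of {R : realType} {X : Type} (d : R -> X -> X -> \bar R)
    (x y : X) (t : \bar R) : R :=
  match t with
  | r%:E => sup [set 1 - lambda | lambda in
                  [set lambda | 0 < lambda <= 1 /\ (d lambda x y < r%:E)%E]]
  | +oo%E => 1
  | -oo%E => 0
  end.

Lemma dist_of_itv {R : realType} {X : Type} (d : R -> X -> X -> \bar R)
  x y t : 0 <= dist_of d x y t <= 1.
Proof.
case: t => [t| |] /=; rewrite ?ler01 ?lexx//.
set S := [set _ | _ in _].
have S1 : ubound S 1 by move=> _ [l [l01 _] <-]; lra.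
have [->|/set0P[v Sv]] := eqVneq S set0; first by rewrite sup0 lexx ler01.
apply/andP; split; last by apply: ge_sup => //; exists v.
apply: le_trans (ub_le_sup _ Sv); last by exists 1.
by case: Sv => l [l01 _] <-; lra.
Qed.

(** (UD) makes the inequality strict: from [d lambda x y < t] it gives a level
    [rho < lambda] with [d rho x y < t], so that
    [1 - lambda < 1 - rho <= dist_of d x y t]. It also makes the levels
    antitone, which the converse rests on. *)
Lemma dist_of_adjoint {R : realType} {X : Type} {d : R -> X -> X -> \bar R} :
  (forall (lambda : R) (x y : X), 0 < lambda <= 1 ->
    d lambda x y =
    ereal_inf [set d rho x y | rho in [set rho : R | 0 < rho < lambda]]) ->
  adjoint d (dist_of d).
Proof.
move=> ud l x y t l01 t0; apply/idP/idP.
  rewrite ud// => /ereal_inf_lt[_ [rho /= rl <-] rt].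
  apply: (@lt_le_trans _ _ (1 - rho)); first by lra.
  apply: ub_le_sup; first by exists 1 => _ [m [m01 _] <-]; lra.
  by exists rho => //; split=> //; lra.
move=> /= ls.
have Sn0 : [set 1 - lambda | lambda in
    [set lambda | 0 < lambda <= 1 /\ (d lambda x y < t%:E)%E]] !=set0.
  by apply/set0P/eqP => S0; move: ls; rewrite S0 sup0; lra.
have [_ [m [m01 mt] <-] lm] := sup_gt Sn0 ls.
apply: le_lt_trans mt; rewrite ud//; apply: ereal_inf_lbound.
by exists m => //=; lra.
Qed.

(** Left continuity at [t]: if [0 < e <= dist_of d x y t], the level [lambda] with
    [1 - lambda = dist_of d x y t - e] satisfies [d lambda x y < t], so every
    [s] between [d lambda x y] and [t] has
    [dist_of d x y t - e < dist_of d x y s]. *)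
Lemma dist_of_distribution {R : realType} {X : Type}
  {d : R -> X -> X -> \bar R} :
  adjoint d (dist_of d) ->
  (forall lambda x y, 0 < lambda <= 1 -> (0 <= d lambda x y)%E) ->
  forall x y, distance_distribution (dist_of d x y).
Proof.
move=> ad d0 x y.
have a1 t : dist_of d x y t <= 1 by case/andP: (dist_of_itv d x y t).
have a0 t : 0 <= dist_of d x y t by case/andP: (dist_of_itv d x y t).
have ale (s t : R) : 0 <= s -> s <= t ->
    dist_of d x y s%:E <= dist_of d x y t%:E.
  move=> s0 st; apply: (adjoint_le ad) => //; first exact: le_trans st.
  by move=> l _ /lt_le_trans; apply; rewrite lee_fin.
split=> //.
- by move=> t _; apply/itv01P; exact: dist_of_itv.
- move=> [s| |] [t| |] //=; rewrite ?lee_fin.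
    exact: ale.
  by move=> _ _; exact: (a1 s%:E).
- apply/le_anti; rewrite a0 andbT leNgt; apply/negP => h.
  have /idP := ad 1 x y 0 ltac:(lra) (lexx _); rewrite subrr h => /idP.
  by rewrite ltNge d0//; lra.
- move=> t t0; apply/cvgrPdist_le => e e0.
  (* When the value at [t] is below [e], [1 - lambda] would be negative, but
     then nonnegativity of [dist_of] suffices. *)
  have [te|te] := ltP (dist_of d x y t%:E) e.
    near=> s.
    have s0 : 0 <= s by near: s; exact: nbhs_left_ge.
    have st : s <= t by near: s; exact: nbhs_left_le.
    rewrite ger0_norm ?subr_ge0; last exact: ale.
    by have := a0 s%:E; lra.
  have l01 : 0 < 1 - (dist_of d x y t%:E - e) <= 1 by have := a1 t%:E; lra.
  have /esym := ad _ x y _ l01 (ltW t0).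
  rewrite subKr ltrBlDr ltrDl e0.
  have := d0 _ x y l01.
  case dl : (d _ x y) => [r| |]//; rewrite lte_fin lee_fin => r0 rt.
  near=> s.
  have s0 : 0 <= s by near: s; exact: nbhs_left_ge.
  have st : s <= t by near: s; exact: nbhs_left_le.
  have rs : (r < s) by near: s; exact: nbhs_left_gt.
  rewrite ger0_norm ?subr_ge0; last exact: ale.
  have := ad _ x y _ l01 s0; rewrite dl lte_fin rs subKr => /esym; lra.
Unshelve. all: by end_near. Qed.

Lemma dist_of_probabilistic_metric {R : realType} {X : Type}
  {d : R -> X -> X -> \bar R}
  {op : R -> R -> R} : adjoint d (dist_of d) ->
  (forall lambda x y, 0 < lambda <= 1 -> (0 <= d lambda x y)%E) ->
  (forall lambda x, 0 < lambda <= 1 -> d lambda x x = 0%E) ->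
  (forall lambda x y, 0 < lambda <= 1 -> d lambda x y = d lambda y x) ->
  continuous_tnorm op ->
  (forall eps lambda lambda' : R, 0 < eps <= 1 ->
    0 < lambda <= 1 -> 0 < lambda' <= 1 ->
    op (1 - lambda') (1 - lambda) > 1 - eps ->
    forall x y z, (d eps x z <= d lambda x y + d lambda' y z)%E) ->
  (forall x y, x <> y ->
    exists lambda : R, 0 < lambda <= 1 /\ (0 < d lambda x y)%E) ->
  probabilistic_metric_space (dist_of d) op.
Proof.
move=> ad d0 dxx dC Top ut uh.
have dd := dist_of_distribution ad d0.
have a1 x y t : dist_of d x y t <= 1 by case/andP: (dist_of_itv d x y t).
have a0 x y t : 0 <= dist_of d x y t by case/andP: (dist_of_itv d x y t).
split=> //.
- move=> x [t| |]// t0; last by rewrite /epsilon0 lt0y.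
  rewrite /epsilon0 lte_fin; move: t0; rewrite lee_fin le_eqVlt.
  move=> /predU1P[<-|t0]; first by rewrite ltxx (dd0 (dd x x)).
  rewrite t0; apply/le_anti; rewrite a1 leNgt; apply/negP => h.
  have l01 : 0 < 1 - dist_of d x x t%:E <= 1 by have := a0 x x t%:E; lra.
  by have := ad _ x x _ l01 (ltW t0); rewrite dxx// lte_fin t0 subKr ltxx.
- move=> x y [t| |]//; rewrite lee_fin => t0.
  by apply/le_anti/andP; split; apply: (adjoint_le ad) => // l l01; rewrite dC.
- move=> x y xy; apply: contrapT => /uh[l [l01]]; apply/negP; rewrite -leNgt.
  apply: lee_lt_fin => // t t0; rewrite lte_fin => {}t0; apply: ltW.
  rewrite ad// ?ltW// xy ?lee_fin ?ltW// /epsilon0 lte_fin t0; lra.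
- have opy x y z r s : op (dist_of d y z r) (dist_of d x y s) <= 1.
    suff /itv01P/andP[] : `[0, 1]%classic
      (op (dist_of d y z r) (dist_of d x y s)) by [].
    by apply: (tnorm_itv Top); apply/itv01P; rewrite a0 a1.
  move=> x y z [r| |] [s| |]//; rewrite ?lee_fin; try by move=> *; exact: opy.
  by move=> r0 s0; apply: (adjoint_prob_triangle ad) => // *;
    exact: dist_of_itv.
Qed.

(** * From a probabilistic metric to levels *)

Lemma dalpha_uniform_basis {R : realType} {X : Type}
  {alpha : X -> X -> \bar R -> R} {op : R -> R -> R} :
  probabilistic_metric_space alpha op ->
  uniform_basis (dalpha alpha @` `]0, 1]%classic).
Proof.
move=> pm; have ad := dalpha_adjoint (pm_P1 pm).
have mem (l : R) : 0 < l <= 1 ->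
    (dalpha alpha @` `]0, 1]%classic) (dalpha alpha l).
  by move=> l01; exists l => //=; rewrite in_itv.
have memP d : (dalpha alpha @` `]0, 1]%classic) d ->
    exists2 l, 0 < l <= 1 & d = dalpha alpha l.
  by move=> [l /=]; rewrite in_itv => ? <-; exists l.
split; first split.
- by move=> d /memP[l l01 ->] x y; exact: dalpha_ge0.
- by exists (dalpha alpha 1); apply: mem; rewrite ltr01 lexx.
- move=> d e /memP[l l01 ->] /memP[m m01 ->].
  have [lm|ml] := leP l m.
    exists (dalpha alpha l); first exact: mem.
    move=> x y; rewrite ge_max lexx /=.
    apply: (adjoint_antitone ad); rewrite ?dalpha_ge0//; lra.
  exists (dalpha alpha m); first exact: mem.
  move=> x y; rewrite ge_max lexx andbT.
  apply: (adjoint_antitone ad); rewrite ?dalpha_ge0//; lra.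
- move=> d x /memP[l l01 ->]; apply/le_anti; rewrite dalpha_ge0 andbT.
  apply: lee_lt_fin => // t t0; rewrite lte_fin => t0'; apply: ltW.
  rewrite ad// (pm_P2 pm) ?lee_fin// /epsilon0 lte_fin t0'; lra.
- move=> d N /memP[l l01 ->] N0.
  have I1 : `[0, 1]%classic (1 : R) by apply/itv01P; rewrite lexx ler01.
  have one : 0 < (1 : R) <= 1 by rewrite ltr01 lexx.
  have lop : 1 - l < op 1 1 by rewrite (tnorm1 (pm_tnorm pm))//; lra.
  (* [op] is close to [1] near [(1, 1)], so two steps at a small enough level
     [m] compose to a step at level [l]. *)
  have [p [q [p1 q1 lpq]]] := tnorm_lt_approx (pm_tnorm pm) one one lop.
  pose m := 1 - Num.max p q.
  have [pm' qm] : p <= 1 - m /\ q <= 1 - m by rewrite subKr !le_max !lexx orbT.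
  have m01 : 0 < m <= 1.
    by rewrite /m; case: (leP p q) => _; lra.
  exists (dalpha alpha m); first exact: mem.
  move=> x y z; rewrite ge_min; apply/orP; left.
  apply: (adjoint_triangle pm ad) => //; first by move=> *; exact: dalpha_ge0.
  apply: lt_le_trans lpq _; apply: (tnorm_le (pm_tnorm pm)) => //;
    by apply/itv01P; lra.
- move=> d /memP[l l01 ->].
  have -> : (fun x y => dalpha alpha l y x) = dalpha alpha l; last exact: mem.
  apply/funext => x; apply/funext => y; apply/le_anti/andP.
  split; apply: lee_lt_fin => [|t t0]; rewrite ?dalpha_ge0// !ad//.
    by rewrite (pm_P3 pm) ?lee_fin// => h; apply: ltW; rewrite ad.
  by rewrite (pm_P3 pm) ?lee_fin// => h; apply: ltW; rewrite ad.
Qed.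

Theorem theorem4p10 (R : realType) (X : Type) (U : set (X -> X -> \bar R))
    (hU : uniform_system U) :
  probabilistic_metrizable U <->
  exists d : R -> X -> X -> \bar R,
    (uniform_basis (d @` `]0, 1]%classic) /\
      U = generated (d @` `]0, 1]%classic)) /\
    (* US *)
    (forall (lambda : R) (x y : X), 0 < lambda <= 1 ->
      d lambda x y = d lambda y x) /\
    (* UD *)
    (forall (lambda : R) (x y : X), 0 < lambda <= 1 ->
      d lambda x y =
      ereal_inf [set d rho x y | rho in [set rho : R | 0 < rho < lambda]]) /\
    (* UT *)
    (exists op : R -> R -> R, continuous_tnorm op /\
      forall eps lambda lambda' : R, 0 < eps <= 1 ->
        0 < lambda <= 1 -> 0 < lambda' <= 1 ->
        op (1 - lambda') (1 - lambda) > 1 - eps ->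
        forall x y z,
          (d eps x z <= d lambda x y + d lambda' y z)%E) /\
    (* UH *)
    (forall x y, x <> y ->
      exists lambda : R, 0 < lambda <= 1 /\ (0 < d lambda x y)%E).
Proof.
split=> [[alpha [op [pm UE]]]|[d [[ub UE] [us [ud [[op [Top ut]] uh]]]]]].
  have ad := dalpha_adjoint (pm_P1 pm).
  have a1 x y (t : R) : 0 <= t -> 0 <= alpha x y t%:E <= 1.
    by move=> t0; apply/itv01P; apply: (dd_itv (pm_P1 pm x y)); rewrite lee_fin.
  have d0 l x y : 0 < l <= 1 -> (0 <= dalpha alpha l x y)%E.
    by move=> _; exact: dalpha_ge0.
  exists (dalpha alpha); split; [split=> //|split; [|split; [|split]]].
  - exact: dalpha_uniform_basis pm.
  - move=> l x y _; congr ereal_inf; apply/seteqP.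
    split=> _ [g [g0 lg] <-]; exists g => //; split=> //.
      by rewrite (pm_P3 pm)// lee_fin.
    by rewrite (pm_P3 pm)// lee_fin.
  - by apply: (adjoint_inf_below ad) => // x y t /(a1 x y)/andP[].
  - by exists op; split; [exact: pm_tnorm pm|exact: adjoint_triangle pm ad d0].
  - move=> x y; apply: contra_notP => /forallNP uh; apply: (pm_P4 pm) => t.
    case: t => [t| |]//; last by rewrite (ddy (pm_P1 pm x y)) /epsilon0 lt0y.
    rewrite /epsilon0 lte_fin lee_fin le_eqVlt => /predU1P[<-|t0].
      by rewrite ltxx (dd0 (pm_P1 pm x y)).
    rewrite t0; apply/le_anti; case/andP: (a1 x y t (ltW t0)) => a0 -> /=.
    rewrite leNgt; apply/negP => at1.
    have l01 : 0 < 1 - alpha x y t%:E <= 1 by lra.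
    apply: (uh (1 - alpha x y t%:E)); split=> //.
    apply: (@lt_le_trans _ _ t%:E); first by rewrite lte_fin.
    by rewrite leNgt ad ?(ltW t0)// subKr ltxx.
have mem (l : R) : 0 < l <= 1 -> (d @` `]0, 1]%classic) (d l).
  by move=> l01; exists l => //=; rewrite in_itv.
have d0 l x y : 0 < l <= 1 -> (0 <= d l x y)%E.
  by move=> /mem dl; exact: (ibasis_sub (ubasis_ideal_basis ub) dl).
have dxx l x : 0 < l <= 1 -> d l x x = 0%E.
  by move=> /mem dl; exact: (ubasis_AU1 ub x dl).
have ad := dist_of_adjoint ud.
have pm := dist_of_probabilistic_metric ad d0 dxx us Top ut uh.
exists (dist_of d), op; split=> //.
have eqd l : `]0, 1]%classic l -> dalpha (dist_of d) l = d l.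
  rewrite /= in_itv => l01.
  apply: (adjoint_eq _ _ (dalpha_adjoint (pm_P1 pm)) ad) => // x y;
    last exact: d0.
  exact: dalpha_ge0.
by rewrite UE /Lambda; congr generated; apply: eq_imagel => l /eqd.
Qed.
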